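(* Every threshold graph is determined by its generalized spectrum: if $G$ is a threshold graph and $H$ is any graph generalized cospectral with $G$, then $H$ is isomorphic to $G$.
   Context: All graphs are finite, simple and undirected. $A(G)$ denotes the adjacency matrix of $G$ and $\overline{G}$ its complement. Two graphs $G$ and $H$ are generalized cospectral if $A(G),A(H)$ have the same multiset of eigenvalues and $A(\overline{G}),A(\overline{H})$ have the same multiset of eigenvalues. A graph $G$ is determined by its generalized spectrum (DGS) if any graph generalized cospectral with $G$ is isomorphic to $G$. A threshold graph is a graph containing no induced subgraph isomorphic to $2K_2$ (disjoint union of two edges), $P_4$ (path on 4 vertices) or $C_4$ (cycle on 4 vertices). *)

(* Defs.v *)
From mathcomp Require Import all_boot all_order all_algebra all_field.

Set Implicit Arguments.
Unset Strict Implicit.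
Unset Printing Implicit Defensive.

Import GRing.Theory.
Local Open Scope ring_scope.

Record sgraph := SGraph {
  vertex :> finType;
  adj : rel vertex;
  adj_sym : symmetric adj;
  adj_irrefl : irreflexive adj }.

Definition isomorphic (G H : sgraph) : Prop :=
  exists2 f : G -> H, bijective f & forall x y, adj (f x) (f y) = adj x y.

Section Complement.
Variable G : sgraph.

Definition compl_adj : rel G := [rel x y | (x != y) && ~~ adj x y].

Lemma compl_adj_sym : symmetric compl_adj.
Proof. by move=> x y; rewrite /compl_adj /= eq_sym adj_sym. Qed.

Lemma compl_adj_irrefl : irreflexive compl_adj.
Proof. by move=> x; rewrite /compl_adj /= eqxx. Qed.

Definition complement : sgraph := SGraph compl_adj_sym compl_adj_irrefl.

End Complement.

Section Induced.
Variables (G : sgraph) (S : {set G}).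

Definition induced_adj : rel {x : G | x \in S} :=
  [rel x y | adj (val x) (val y)].

Lemma induced_adj_sym : symmetric induced_adj.
Proof. by move=> x y; rewrite /induced_adj /= adj_sym. Qed.

Lemma induced_adj_irrefl : irreflexive induced_adj.
Proof. by move=> x; rewrite /induced_adj /= adj_irrefl. Qed.

Definition induced : sgraph := SGraph induced_adj_sym induced_adj_irrefl.

End Induced.

Definition has_induced (F G : sgraph) : Prop :=
  exists S : {set G}, isomorphic (induced S) F.

(* Edges 01 and 23. *)
Definition twoK2_adj : rel 'I_4 := [rel i j : 'I_4 | (i != j) && (i./2 == j./2)%N].

Lemma twoK2_adj_sym : symmetric twoK2_adj.
Proof. by move=> i j; rewrite /twoK2_adj /= eq_sym [(_./2 == _)%N]eq_sym. Qed.

Lemma twoK2_adj_irrefl : irreflexive twoK2_adj.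
Proof. by move=> i; rewrite /twoK2_adj /= eqxx. Qed.

Definition twoK2 : sgraph := SGraph twoK2_adj_sym twoK2_adj_irrefl.

(* Edges 01, 12 and 23. *)
Definition P4_adj : rel 'I_4 := [rel i j : 'I_4 | (i.+1 == j)%N || (j.+1 == i)%N].

Lemma P4_adj_sym : symmetric P4_adj.
Proof. by move=> i j; rewrite /P4_adj /= orbC. Qed.

Lemma P4_adj_irrefl : irreflexive P4_adj.
Proof. by case=> [[|[|[|[|]]]]]. Qed.

Definition P4 : sgraph := SGraph P4_adj_sym P4_adj_irrefl.

(* Edges 01, 12, 23 and 30. *)
Definition C4_adj : rel 'I_4 :=
  [rel i j : 'I_4 | (i.+1 %% 4 == j)%N || (j.+1 %% 4 == i)%N].

Lemma C4_adj_sym : symmetric C4_adj.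
Proof. by move=> i j; rewrite /C4_adj /= orbC. Qed.

Lemma C4_adj_irrefl : irreflexive C4_adj.
Proof. by case=> [[|[|[|[|]]]]]. Qed.

Definition C4 : sgraph := SGraph C4_adj_sym C4_adj_irrefl.

Definition threshold (G : sgraph) : Prop :=
  [/\ ~ has_induced twoK2 G, ~ has_induced P4 G & ~ has_induced C4 G].

(* Vertices are numbered by [enum_val]; the spectrum does not depend on the
   numbering.  The entries are taken in [algC], which contains all eigenvalues
   (real algebraic integers) of a symmetric 0-1 matrix. *)
Definition adjmx (G : sgraph) : 'M[algC]_#|G| :=
  \matrix_(i, j) (adj (enum_val i) (enum_val j))%:R.

(* Multiplicity of [a] as an eigenvalue of [A]: 0 iff [a] is not an eigenvalue. *)
Definition eigenmult n (A : 'M[algC]_n) (a : algC) : nat :=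
  mup a (char_poly A).

(* Equality of the multisets of eigenvalues, given by their multiplicity
   functions; the sizes of the matrices are not assumed to be equal. *)
Definition same_spectrum m n (A : 'M[algC]_m) (B : 'M[algC]_n) : Prop :=
  forall a : algC, eigenmult A a = eigenmult B a.

Definition generalized_cospectral (G H : sgraph) : Prop :=
  same_spectrum (adjmx G) (adjmx H) /\
  same_spectrum (adjmx (complement G)) (adjmx (complement H)).

Definition DGS (G : sgraph) : Prop :=
  forall H : sgraph, generalized_cospectral H G -> isomorphic H G.

(* Main.v *)
Require Import Defs.
From mathcomp Require Import all_boot all_order all_algebra all_field all_fingroup.
From mathcomp Require Import ring lra.

(* Write e for the all-ones vector. Equality of both characteristic polynomials
   determines e^T adj(x - A) e, because det(x - A + e e^T) is up to sign the
   characteristic polynomial of the complement at -x-1; this determines all walk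
   counts e^T A^k e. A graph is threshold iff it has no alternating 4-cycle, and
   with C = J - I - A the number tr(ACAC) of these is a polynomial in the walk
   counts and the traces of the powers of A; so the cospectral mate H of the
   threshold graph G is threshold as well. A threshold graph has an isolated or
   a dominating vertex. If u is isolated in G and d dominating in H, let w and z
   be the projections of e to the kernels of A(G) and A(H): then
   |w|^2 = e^T w = e^T z = |z|^2 by equality of walk counts, w_u = 1 gives
   |w|^2 >= 1, and (A(H) z)_d = 0 gives z_d = |z|^2, which forces z to be the
   unit vector at d, so that d is isolated. Hence, up to complementing, both
   graphs have an isolated vertex; deleting these preserves generalized
   cospectrality, and induction applies. *)

Set Implicit Arguments.
Unset Strict Implicit.
Unset Printing Implicit Defensive.

Import Order.TTheory GRing.Theory Num.Theory.
Local Open Scope ring_scope.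

(** * Determinants of bordered matrices and rank-one updates *)

(** A Schur complement with the adjugate in place of the inverse, since [M] will be a characteristic
    matrix over polynomials; this costs an extra factor [\det M], which cancels. *)
Lemma det_bordered (R : idomainType) n (a : R) (v : 'rV_n) (u : 'cV_n)
    (M : 'M_n) :
  \det M != 0 ->
  \det (block_mx a%:M v u M) = a * \det M - (v *m \adj M *m u) 0 0.
Proof.
move=> M0; apply: (mulIf M0).
have : block_mx a%:M v u M *m block_mx (\det M)%:M 0 (- (\adj M *m u)) 1%:M
     = block_mx ((a * \det M)%:M - v *m \adj M *m u) v 0 M.
  rewrite mulmx_block !mulmxN !mulmx0 !mulmx1 !add0r -scalar_mxM !mulmxA.
  by rewrite mul_mx_adj mul_mx_scalar mul_scalar_mx subrr.
move/(congr1 determinant); rewrite det_mulmx det_lblock det_ublock det1 mulr1.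
by rewrite det_scalar1 det_mx11 !mxE eqxx mulr1n.
Qed.

(** The matrix bordered by 1, [v] and [- u] is evaluated twice: by [det_bordered], and by clearing
    [v] with a column operation. *)
Lemma det_rank1_update (R : idomainType) n (v : 'rV_n) (u : 'cV_n)
    (M : 'M[R]_n) :
  \det M != 0 -> \det (M + u *m v) = \det M + (v *m \adj M *m u) 0 0.
Proof.
move=> M0.
have := det_bordered 1 v (- u) M0.
rewrite mulmxN mxE opprK mul1r => <-.
have : block_mx 1%:M v (- u) M *m block_mx 1%:M (- v) 0 1%:M
     = block_mx 1%:M 0 (- u) (M + u *m v).
  rewrite mulmx_block !mulmx0 !mulmx1 !mul1mx !addr0 mulNmx mulmxN opprK.
  by rewrite addNr addrC.
move/(congr1 determinant); rewrite det_mulmx det_lblock det_ublock !det1.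
by rewrite !mul1r mulr1.
Qed.

(** * Walk counts and the resolvent *)

Section Walks.
Variable F : fieldType.
Implicit Types (n m k : nat).

Definition ones (R : pzRingType) n : 'cV[R]_n := const_mx 1.

Definition walks n (A : 'M[F]_n) k : F :=
  ((ones F n)^T *m A ^+ k *m ones F n) 0 0.

(* The numerator [e^T adj(x - A) v] of [e^T (x - A)^-1 v]. *)
Definition resolvent_num n (A : 'M[F]_n) (v : 'cV[F]_n) : {poly F} :=
  ((ones _ n)^T *m \adj (char_poly_mx A) *m map_mx polyC v) 0 0.

(** Up to sign, the entries of the adjugate are minors of order [n - 1] of a matrix with entries of
    degree at most 1. *)
Lemma size_resolvent_num n (A : 'M[F]_n) v : (size (resolvent_num A v) <= n)%N.
Proof.
case: n A v => [|n] A v.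
  by rewrite /resolvent_num mxE big_ord0 size_poly0.
rewrite /resolvent_num mxE; apply: leq_trans (size_sum _ _ _) _.
apply/bigmax_leqP => j _; rewrite [map_mx _ _ _ _]mxE mulrC mul_polyC.
apply: leq_trans (size_scale_leq _ _) _.
rewrite mxE; apply: leq_trans (size_sum _ _ _) _.
apply/bigmax_leqP => i _; rewrite !mxE mul1r /cofactor size_Msign.
apply: leq_trans (size_sum _ _ _) _.
apply/bigmax_leqP => s _; rewrite size_Msign.
apply: leq_trans (size_poly_prod_leq _ _) _.
rewrite leq_subLR card_ord.
have -> : (n + n.+1 = (\sum_(l < n) 2).+1)%N.
  by rewrite sum_nat_const card_ord muln2 -addnn addnS.
rewrite ltnS; apply: leq_sum => l _; rewrite !mxE.
apply: leq_trans (size_polyD _ _) _; rewrite geq_max size_polyN.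
rewrite (leq_trans (size_polyC_leq1 _)) // -mulr_natr -polyC_natr mulrC mul_polyC.
by rewrite (leq_trans (size_scale_leq _ _)) ?size_polyX.
Qed.

Lemma char_poly_neq0 n (A : 'M[F]_n) : char_poly A != 0.
Proof. exact/monic_neq0/char_poly_monic. Qed.

(** Since [adj(x - A) (x - A)] is the scalar matrix [char_poly A], it remains to apply both sides to
    [v]. *)
Lemma resolvent_num_step n (A : 'M[F]_n) v :
  'X * resolvent_num A v - resolvent_num A (A *m v) =
  char_poly A * (((ones F n)^T *m v) 0 0)%:P.
Proof.
have -> : (((ones F n)^T *m v) 0 0)%:P =
    ((ones {poly F} n)^T *m map_mx polyC v) 0 0.
  rewrite !mxE rmorph_sum; apply: eq_bigr => i _ /=.
  by rewrite !mxE rmorphM rmorph1.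
have scale00 c (B : 'M[{poly F}]_1) : c * B 0 0 = (c *: B) 0 0 by rewrite [RHS]mxE.
have sub00 (B C : 'M[{poly F}]_1) : B 0 0 - C 0 0 = (B - C) 0 0 by rewrite !mxE.
rewrite /resolvent_num map_mxM !scale00 sub00 /=; congr (fun_of_matrix _ 0 0).
rewrite -!mulmxA !scalemxAr -mulmxBr; congr (_ *m _).
rewrite -mulmxBr -[RHS]mul_scalar_mx /char_poly -mul_adj_mx -mulmxA.
by rewrite {3}/char_poly_mx mulmxBl mul_scalar_mx.
Qed.

(** In the recurrence [stepS] the characteristic polynomial is monic of degree [n] and [S M k.+1]
    has smaller degree, so the coefficient at degree [n] reads off [walks M k]. Hence [char_poly M]
    and [S M 0] determine everything by induction. *)
Lemma walks_eq n (A B : 'M[F]_n) :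
  char_poly A = char_poly B ->
  resolvent_num A (ones F n) = resolvent_num B (ones F n) ->
  walks A =1 walks B.
Proof.
move=> eq_phi eq0.
pose S (M : 'M[F]_n) k := resolvent_num M (M ^+ k *m ones F n).
have stepS M k : 'X * S M k - S M k.+1 = char_poly M * (walks M k)%:P.
  by rewrite /S exprS -[M * _]/(M *m _) -mulmxA resolvent_num_step /walks mulmxA.
have walkS M k : walks M k = ('X * S M k)`_n.
  have := congr1 (fun p : {poly F} => p`_n) (stepS M k).
  rewrite coefB [(S M k.+1)`_n]nth_default ?size_resolvent_num // subr0 => ->.
  rewrite mulrC coefCM.
  have := char_poly_monic M; rewrite monicE lead_coefE size_char_poly /=.
  by move/eqP->; rewrite mulr1.
have eqS k : S A k = S B k.
  elim: k => [|k IH]; first by rewrite /S !expr0 !mul1mx.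
  have := stepS B k; rewrite -eq_phi walkS -IH -walkS -stepS.
  by move/addrI/oppr_inj.
by move=> k; rewrite !walkS eqS.
Qed.

End Walks.

(** * Complements and deletion of an isolated vertex *)

Section GeneralizedCospectrality.
Variable F : fieldType.
Implicit Types n : nat.

Definition complmx n (A : 'M[F]_n) : 'M[F]_n := const_mx 1 - 1%:M - A.

Definition cospectral_with_compl n (A B : 'M[F]_n) :=
  char_poly A = char_poly B /\ char_poly (complmx A) = char_poly (complmx B).

Lemma complmxK n : involutive (@complmx n).
Proof. by move=> A; rewrite /complmx opprB addrC subrK. Qed.

Lemma cospectral_sym n (A B : 'M[F]_n) :
  cospectral_with_compl A B -> cospectral_with_compl B A.
Proof. by case=> eqA eqC; split; apply: esym. Qed.

Lemma ones_mul_tr (R : pzRingType) m n :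
  ones R m *m (ones R n)^T = const_mx 1.
Proof. by apply/matrixP => i j; rewrite !mxE big_ord1 !mxE mulr1. Qed.

(** At [- 'X - 1] the characteristic matrix of [complmx A] becomes [-(x - A + J)] with [J] all ones,
    a rank-one update of [x - A] up to sign. *)
Lemma resolvent_num_complmx n (A : 'M[F]_n) :
  char_poly A + resolvent_num A (ones F n) =
  (-1) ^+ n * (char_poly (complmx A) \Po (- 'X - 1)).
Proof.
have -> : resolvent_num A (ones F n) =
    ((ones _ n)^T *m \adj (char_poly_mx A) *m ones _ n) 0 0.
  by rewrite /resolvent_num /ones map_const_mx rmorph1.
rewrite -det_rank1_update ?char_poly_neq0 // ones_mul_tr.
rewrite /char_poly -[_ \Po _]/(comp_poly _ _) -det_map_mx -detZ.
congr (\det _); apply/matrixP => i j; rewrite !mxE.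
rewrite rmorphB rmorphMn /= comp_polyX comp_polyC !rmorphB !rmorphMn /= rmorph1.
by case: eqP => _ /=; rewrite ?mulr1n ?mulr0n; ring.
Qed.

Lemma cospectral_resolvent_num n (A B : 'M[F]_n) :
  cospectral_with_compl A B ->
  resolvent_num A (ones F n) = resolvent_num B (ones F n).
Proof.
case=> eqA eqC; apply: (addrI (char_poly A)).
by rewrite {2}eqA (resolvent_num_complmx A) (resolvent_num_complmx B) eqC.
Qed.

Lemma cospectral_walks n (A B : 'M[F]_n) :
  cospectral_with_compl A B -> walks A =1 walks B.
Proof.
by move=> AB; apply: walks_eq; [case: AB | apply: cospectral_resolvent_num].
Qed.

Lemma cospectral_complmx n (A B : 'M[F]_n) :
  cospectral_with_compl A B -> cospectral_with_compl (complmx A) (complmx B).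
Proof. by case=> eqA eqC; split; rewrite ?complmxK. Qed.

Definition add_isolated n (A : 'M[F]_n) : 'M[F]_(1 + n) := block_mx 0 0 0 A.

Lemma char_poly_mx_block n (a : F) (v : 'rV_n) (u : 'cV_n) (A : 'M_n) :
  char_poly_mx (block_mx a%:M v u A) =
  block_mx ('X - a%:P)%:M (- map_mx polyC v) (- map_mx polyC u)
           (char_poly_mx A).
Proof.
rewrite /char_poly_mx map_block_mx map_scalar_mx [('X)%:M]scalar_mx_block.
by rewrite opp_block_mx add_block_mx !add0r raddfB.
Qed.

Lemma char_poly_add_isolated n (A : 'M[F]_n) :
  char_poly (add_isolated A) = 'X * char_poly A.
Proof.
rewrite /char_poly /add_isolated -[X in block_mx X](raddf0 (@scalar_mx F 1)).
rewrite char_poly_mx_block !map_mx0 !oppr0.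
by rewrite det_lblock det_scalar1 addr0.
Qed.

Lemma complmx_add_isolated n (A : 'M[F]_n) :
  complmx (add_isolated A) = block_mx 0%:M (const_mx 1) (const_mx 1) (complmx A).
Proof.
rewrite /complmx /add_isolated scalar_mx_block -(block_mx_const 1).
rewrite !opp_block_mx !add_block_mx !oppr0 !addr0; congr block_mx.
by rewrite raddf0; apply/matrixP=> i j; rewrite !mxE !ord1 subrr.
Qed.

(** The new vertex dominates in the complement, so the border is all ones; the resulting resolvent
    term of [complmx A] is eliminated by [resolvent_num_complmx]. *)
Lemma char_poly_complmx_add_isolated n (A : 'M[F]_n) :
  char_poly (complmx (add_isolated A)) =
  ('X + 1) * char_poly (complmx A) - (-1) ^+ n * (char_poly A \Po (- 'X - 1)).
Proof.
rewrite /char_poly complmx_add_isolated char_poly_mx_block subr0.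
rewrite det_bordered ?char_poly_neq0 // !(mulNmx, mulmxN) opprK.
have := resolvent_num_complmx (complmx A); rewrite complmxK => <-.
rewrite /resolvent_num /ones trmx_const !map_const_mx rmorph1.
rewrite [char_poly (complmx A)]/char_poly; ring.
Qed.

(** The first equation yields [char_poly A = char_poly B] by cancelling ['X]; then the last terms of
    the second agree and ['X + 1] cancels. *)
Lemma cospectral_del_isolated n (A B : 'M[F]_n) :
  cospectral_with_compl (add_isolated A) (add_isolated B) ->
  cospectral_with_compl A B.
Proof.
case; rewrite !char_poly_add_isolated !char_poly_complmx_add_isolated.
have X0 : 'X != 0 :> {poly F} by rewrite polyX_eq0.
move=> eqXA eqC; have eqA : char_poly A = char_poly B by apply: (mulfI X0).
split; first exact: eqA.
move: eqC; rewrite eqA => /addIr /mulfI; apply.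
by rewrite -size_poly_eq0 size_XaddC.
Qed.

Lemma char_poly_perm n (s : 'S_n) (A : 'M[F]_n) :
  char_poly (\matrix_(i, j) A (s i) (s j)) = char_poly A.
Proof.
rewrite /char_poly.
have -> : char_poly_mx (\matrix_(i, j) A (s i) (s j)) =
    row_perm s (col_perm s (char_poly_mx A)).
  by apply/matrixP => i j; rewrite !mxE (inj_eq perm_inj).
rewrite row_permE col_permE !det_mulmx !det_perm odd_permV mulrC -mulrA.
by rewrite -signr_addb addbb mulr1.
Qed.

End GeneralizedCospectrality.

(** * Traces of powers as spectral invariants *)

Lemma char_poly_conj (R : comUnitRingType) n (P A : 'M[R]_n) :
  P \in unitmx -> char_poly (invmx P *m A *m P) = char_poly A.
Proof.
move=> uP; pose f := map_mx (@polyC R).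
have fV : f n n (invmx P) *m f n n P = 1%:M by rewrite /f -map_mxM mulVmx // map_mx1.
have -> : char_poly (invmx P *m A *m P) =
    \det (f n n (invmx P) *m char_poly_mx A *m f n n P).
  rewrite /char_poly /char_poly_mx mulmxBr mulmxBl mul_mx_scalar -scalemxAl fV.
  by rewrite /f !map_mxM scalemx1.
by rewrite !det_mulmx mulrC mulrA -det_mulmx (mulmx1C fV) det1 mul1r.
Qed.

Lemma tr_pow_conj_diag (R : comUnitRingType) n (P : 'M[R]_n) d k :
  P \in unitmx ->
  \tr ((invmx P *m diag_mx d *m P) ^+ k) = \sum_i d 0 i ^+ k.
Proof.
move=> uP.
have -> : (invmx P *m diag_mx d *m P) ^+ k =
    invmx P *m diag_mx (\row_i d 0 i ^+ k) *m P.
  elim: k => [|k IH].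
    have -> : \row_i d 0 i ^+ 0 = const_mx 1 by apply/rowP => i; rewrite !mxE.
    by rewrite diag_const_mx mulmx1 mulVmx.
  rewrite exprS IH -[LHS]/(_ *m _) !mulmxA mulmxK // -[_ *m diag_mx d *m _]mulmxA.
  rewrite mulmx_diag; congr (_ *m diag_mx _ *m _).
  by apply/rowP => i; rewrite !mxE exprS.
rewrite mxtrace_mulC mulmxA mulmxV // mul1mx mxtrace_diag.
by apply: eq_bigr => i _; rewrite mxE.
Qed.

(** Both matrices are diagonalizable, the characteristic polynomial fixes the diagonal up to order,
    and the traces are its power sums. *)
Lemma normalmx_tr_pow_eq (C : numClosedFieldType) n (A B : 'M[C]_n) k :
  A \is normalmx -> B \is normalmx -> char_poly A = char_poly B ->
  \tr (A ^+ k) = \tr (B ^+ k).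
Proof.
move=> /orthomx_spectralP -> /orthomx_spectralP ->.
rewrite !(char_poly_conj _ (spectral_unit _)).
rewrite !(tr_pow_conj_diag _ _ (spectral_unit _)).
move: (spectral_diag A) (spectral_diag B) => a b.
have diagE (d : 'rV[C]_n) : char_poly (diag_mx d) =
    \prod_(x <- [seq d 0 i | i <- index_enum 'I_n]) ('X - x%:P).
  rewrite char_poly_trig ?diag_mx_is_trig // big_map.
  by apply: eq_bigr => i _; rewrite mxE eqxx.
rewrite !diagE => /prod_XsubC_eq eqab.
have : \sum_(x <- [seq a 0 i | i <- index_enum 'I_n]) x ^+ k =
    \sum_(x <- [seq b 0 i | i <- index_enum 'I_n]) x ^+ k by apply: perm_big.
by rewrite !big_map.
Qed.

(** Diagonalization takes place in [algC]; the equality is pulled back along the injective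
    [ratr]. *)
Lemma sym_rat_tr_pow_eq n (A B : 'M[rat]_n) k :
  A^T = A -> B^T = B -> char_poly A = char_poly B ->
  \tr (A ^+ k) = \tr (B ^+ k).
Proof.
move=> symA symB eqAB.
have normal (M : 'M[rat]_n) : M^T = M -> map_mx (ratr : rat -> algC) M \is normalmx.
  move=> symM; apply: symmetric_normalmx.
    apply/is_hermitianmxP; rewrite expr0 scale1r -{1}symM.
    by apply/matrixP => i j; rewrite !mxE.
  by apply/mxOverP => i j; rewrite mxE; exact: rpred_rat.
have mapX (M : 'M[rat]_n) : map_mx (ratr : rat -> algC) (M ^+ k) = (map_mx ratr M) ^+ k.
  elim: k => [|k IH]; first by rewrite !expr0 map_mx1.
  by rewrite !exprS -IH -[_ * _]/(_ *m _) map_mxM.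
apply: (fmorph_inj (ratr : {rmorphism rat -> algC})) => /=.
rewrite -!trace_map_mx !mapX; apply: normalmx_tr_pow_eq; try exact: normal.
by rewrite -!map_char_poly eqAB.
Qed.

(** * Counting alternating 4-cycles *)

Section AlternatingCycles.
Variable F : fieldType.

Lemma tr_mul_const1 n (X : 'M[F]_n) :
  \tr (X *m const_mx 1) = ((ones F n)^T *m X *m ones F n) 0 0.
Proof. by rewrite -ones_mul_tr mulmxA mxtrace_mulC mulmxA trace_mx11. Qed.

(** Expand [A *m complmx A] as [A *m J - (A + A ^+ 2)]; since [J] is [e e^T], the traces containing
    it become walk counts. *)
Lemma tr_alternating n (A : 'M[F]_n) :
  \tr ((A *m complmx A) *m (A *m complmx A)) =
  walks A 1 ^+ 2 - (walks A 2 + walks A 3) *+ 2 +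
  (\tr (A ^+ 2) + \tr (A ^+ 3) *+ 2 + \tr (A ^+ 4)).
Proof.
set J : 'M[F]_n := const_mx 1; pose P := A + A ^+ 2.
have -> : A *m complmx A = A *m J - P.
  by rewrite /complmx -addrA -opprD mulmxBr mulmxDr mulmx1.
rewrite mulmxBl !mulmxBr !raddfB /= [\tr (A *m J *m P)]mxtrace_mulC.
have -> : \tr (A *m J *m (A *m J)) = walks A 1 ^+ 2.
  rewrite mulmxA tr_mul_const1 /J -ones_mul_tr /walks expr1.
  set w := (ones F n)^T *m A *m ones F n.
  have -> : (ones F n)^T *m (A *m (ones F n *m (ones F n)^T) *m A) *m ones F n = w *m w.
    by rewrite /w !mulmxA.
  by rewrite mxE big_ord1.
have -> : \tr (P *m (A *m J)) = walks A 2 + walks A 3.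
  rewrite mulmxA tr_mul_const1 /walks -[_ *m A]/(P * A) /P mulrDl -expr2 -exprSr.
  by rewrite mulmxDr mulmxDl mxE.
have -> : P *m P = A ^+ 2 + A ^+ 3 *+ 2 + A ^+ 4.
  rewrite -[LHS]/(P * P) /P mulrDl !mulrDr -expr2 -exprS -exprSr -exprD.
  by rewrite mulr2n !addrA.
by rewrite !raddfD /=; ring.
Qed.

End AlternatingCycles.

(** * Projection of the all-ones vector onto the kernel *)

Section KernelProjection.
Variable F : realFieldType.

Lemma sqnorm_eq0 n (z : 'cV[F]_n) : z^T *m z = 0 -> z = 0.
Proof.
move/matrixP/(_ 0 0); rewrite mxE [RHS]mxE => z0; apply/colP => i.
rewrite [RHS]mxE; apply/eqP; rewrite -sqrf_eq0 expr2.
have /(psumr_eq0P _) : \sum_j z^T 0 j * z j 0 = 0 by [].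
move=> /(_ _ i isT); rewrite mxE => -> // j _.
by rewrite mxE -expr2 sqr_ge0.
Qed.

Lemma sym_pow_ker n (A : 'M[F]_n) (z : 'cV_n) m :
  A^T = A -> A ^+ m *m z = 0 -> A *m z = 0.
Proof.
move=> symA; case: m => [|m]; first by rewrite mul1mx => ->; rewrite mulmx0.
elim: m => [|m IH] Az0; first by rewrite expr1 in Az0.
apply/IH/sqnorm_eq0; rewrite trmx_mul.
have -> : (A ^+ m.+1)^T = A ^+ m.+1.
  elim: (m.+1) => [|k IHk]; first by rewrite trmx1.
  by rewrite {1}exprS -[_ * _]/(_ *m _) trmx_mul IHk symA -[LHS]/(_ * _) -exprSr.
rewrite -mulmxA [X in _ *m X]mulmxA -[A ^+ _ *m A ^+ _]/(_ * _) -exprD.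
by rewrite -addSnnS addnC exprD -[_ * _]/(_ *m _) -mulmxA Az0 !mulmx0.
Qed.

Lemma horner_mx_ker n (A : 'M[F]_n.+1) (v : 'cV_n.+1) p :
  A *m v = 0 -> horner_mx A p *m v = p.[0] *: v.
Proof.
move=> Av; elim/poly_ind: p => [|p c _].
  by rewrite rmorph0 mul0mx horner0 scale0r.
rewrite rmorphD rmorphM /= horner_mx_X horner_mx_C mulmxDl -mulmxA Av mulmx0.
by rewrite add0r mul_scalar_mx !hornerE.
Qed.

Lemma horner_mx_sym n (A : 'M[F]_n.+1) p :
  A^T = A -> (horner_mx A p)^T = horner_mx A p.
Proof.
move=> symA; elim/poly_ind: p => [|p c IH]; first by rewrite rmorph0 trmx0.
rewrite rmorphD rmorphM /= horner_mx_X horner_mx_C raddfD /= tr_scalar_mx.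
rewrite trmx_mul symA IH; congr (_ + _).
exact: esym (comm_horner_mx p (erefl (A *m A))).
Qed.

Lemma walks_horner n (A B : 'M[F]_n.+1) p :
  walks A =1 walks B ->
  (ones F _)^T *m horner_mx A p *m ones F _ =
  (ones F _)^T *m horner_mx B p *m ones F _.
Proof.
move=> AB.
(* The extra power absorbs the factor ['X] that each step of [poly_ind] produces. *)
suff H k : (ones F _)^T *m (horner_mx A p *m A ^+ k) *m ones F _ =
    (ones F _)^T *m (horner_mx B p *m B ^+ k) *m ones F _.
  by have := H 0%N; rewrite !mulmx1.
elim/poly_ind: p k => [|p c IH] k; first by rewrite !rmorph0 !mul0mx.
rewrite !rmorphD !rmorphM /= !horner_mx_X !horner_mx_C.
have step (M : 'M[F]_n.+1) : (horner_mx M p * M + c%:M) *m M ^+ k =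
    horner_mx M p *m M ^+ k.+1 + c *: M ^+ k.
  by rewrite mulmxDl mul_scalar_mx exprS mulmxA.
rewrite !step !mulmxDr !mulmxDl IH; congr (_ + _).
rewrite -!scalemxAr -!scalemxAl; congr (_ *: _).
by apply/matrixP => i j; rewrite !ord1; apply: AB.
Qed.

(* [q(A)] is the orthogonal projection onto the kernel of [A]. *)
Lemma kernel_projection n (A : 'M[F]_n.+1) q m (a : F)
    (w := horner_mx A q *m ones F n.+1) :
  A^T = A -> char_poly A = a *: q * 'X^m -> a != 0 -> q.[0] = 1 ->
  [/\ A *m w = 0, w^T *m w = (ones F _)^T *m w &
      forall v : 'cV_n.+1, A *m v = 0 -> v^T *m w = v^T *m ones F _ ].
Proof.
move=> symA eq_phi a0 q0.
have Aw : A *m w = 0.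
  (* Cayley-Hamilton gives [A ^+ m *m w = 0]. *)
  apply: (@sym_pow_ker _ _ _ m) => //.
  have /eqP := Cayley_Hamilton A.
  rewrite eq_phi -scalerAl linearZ /= scaler_eq0 (negPf a0) /= => /eqP.
  rewrite mulrC rmorphM rmorphXn /= horner_mx_X => qX.
  by rewrite /w mulmxA -[A ^+ m *m _]/(_ * _) qX mul0mx.
have kerE (v : 'cV_n.+1) : A *m v = 0 -> v^T *m w = v^T *m ones F _.
  move=> Av; rewrite /w mulmxA -[v^T *m _]trmxK trmx_mul trmxK horner_mx_sym //.
  by rewrite horner_mx_ker // q0 scale1r.
split=> //; rewrite kerE //.
rewrite -[LHS]trmxK trmx_mul trmxK.
by apply/matrixP => i j; rewrite mxE !ord1.
Qed.

(** Equal characteristic polynomials let one polynomial [q] define both kernel projections, so equal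
    walk counts compare the two projected vectors. The index [i] excludes a single vertex, which is
    isolated and dominating at once. *)
Lemma isolated_neq_dominating n (A B : 'M[F]_n.+1) u d i :
  A^T = A -> B^T = B -> char_poly A = char_poly B -> walks A =1 walks B ->
  (forall j, A u j = 0) -> (forall j, B d j = (j != d)%:R) -> i != d -> False.
Proof.
move=> symA symB eqAB walkAB Au Bd i_d.
have [m [q0 q0P def_phi]] := multiplicity_XsubC (char_poly A) 0.
rewrite char_poly_neq0 /= in q0P.
pose q := q0.[0]^-1 *: q0; pose a := q0.[0].
have a0 : a != 0 by [].
have phiA : char_poly A = a *: q * 'X^m.
  by rewrite /q scalerA mulfV // scale1r def_phi subr0.
have q1 : q.[0] = 1 by rewrite hornerZ mulVf.
have [Aw ww Aker] := kernel_projection symA phiA a0 q1.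
have [Bz zz _] := kernel_projection symB (etrans (esym eqAB) phiA) a0 q1.
have := walks_horner q walkAB; rewrite -!mulmxA.
set w := horner_mx A q *m _ in Aw ww Aker *.
set z := horner_mx B q *m _ in Bz zz *.
move=> wz; clearbody w z.
(* The unit vector at [u] lies in the kernel, so it pairs with [w] as it does with the all-ones
   vector. *)
have w_u : w u 0 = 1.
  have Au0 : A *m delta_mx u 0 = 0 :> 'cV_n.+1.
    by rewrite -colE; apply/colP => j; rewrite -symA !mxE Au.
  have /matrixP/(_ 0 0) := Aker _ Au0.
  by rewrite trmx_delta -!rowE !mxE.
have ge1 : 1 <= (w^T *m w) 0 0.
  rewrite mxE (bigD1 u) //= mxE w_u mulr1 lerDl.
  by apply: sumr_ge0 => j _; rewrite mxE -expr2 sqr_ge0.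
(* Row [d] of [B *m z = 0] makes the entries of [z] off [d] sum to 0, hence [e^T z] is [z d 0]. *)
have z_d : z d 0 = (z^T *m z) 0 0.
  have Bzd : \sum_j B d j * z j 0 = 0.
    by have /matrixP/(_ d 0) := Bz; rewrite mxE [RHS]mxE.
  move: Bzd; rewrite (bigD1 d) //= Bd eqxx mul0r add0r => sum0.
  rewrite zz mxE (bigD1 d) //= !mxE mul1r -[LHS]addr0; congr (_ + _).
  by rewrite -[LHS]sum0; apply: eq_bigr => j jd; rewrite !mxE Bd jd.
have norm_z : (z^T *m z) 0 0 = z d 0 ^+ 2 + \sum_(j | j != d) z j 0 ^+ 2.
  rewrite mxE (bigD1 d) //= mxE expr2; congr (_ + _).
  by apply: eq_bigr => j _; rewrite mxE.
rewrite ww wz -zz -z_d in ge1; rewrite -z_d in norm_z.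
have sum_ge0 : 0 <= \sum_(j | j != d) z j 0 ^+ 2.
  by apply: sumr_ge0 => j _; rewrite sqr_ge0.
(* The entry is at least 1 and equals its own square plus a nonnegative sum. *)
have zd1 : z d 0 = 1 by nra.
have /psumr_eq0P z0 : \sum_(j | j != d) z j 0 ^+ 2 = 0 by nra.
have /matrixP/(_ i 0) := Bz; rewrite mxE (bigD1 d) //= zd1 mulr1 big1 => [|j jd].
  by rewrite -symB !mxE Bd i_d addr0 => /eqP; rewrite oner_eq0.
have /eqP := z0 (fun j _ => sqr_ge0 _) j jd.
by rewrite sqrf_eq0 => /eqP ->; rewrite mulr0.
Qed.

End KernelProjection.

(** * Relations without alternating 4-cycles *)

Section AlternatingFree.
Variable T : finType.
Implicit Types r : rel T.

Definition compl_rel r : rel T := [rel x y | (x != y) && ~~ r x y].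

(* For a graph this excludes exactly the induced 2K2, P4 and C4. *)
Definition alt4_free r :=
  forall a b c d, r a b -> compl_rel r b c -> r c d -> compl_rel r d a -> False.

Lemma compl_relK r : irreflexive r -> compl_rel (compl_rel r) =2 r.
Proof.
move=> irr x y; rewrite /compl_rel /=; case: eqVneq => [->|_] /=.
  by rewrite irr.
by rewrite negbK.
Qed.

(** Complementing swaps the two kinds of steps, so the same cycle started at [d] alternates for
    [r]. *)
Lemma alt4_free_compl r : irreflexive r -> alt4_free r -> alt4_free (compl_rel r).
Proof.
move=> irr free a b c d ab bc cd da; rewrite !compl_relK // in bc da.
exact: (free d a b c).
Qed.

Lemma compl_rel_sym r : symmetric r -> symmetric (compl_rel r).
Proof. by move=> sym x y; rewrite /compl_rel /= eq_sym sym. Qed.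

Lemma compl_rel_irr r : irreflexive (compl_rel r).
Proof. by move=> x; rewrite /compl_rel /= eqxx. Qed.

(* A vertex of maximal degree is adjacent to all non-isolated vertices. *)
Lemma isolated_or_dominating r (x0 : T) :
  symmetric r -> irreflexive r -> alt4_free r ->
  (exists u, forall x, r u x = false) \/ (exists d, forall x, r d x = (x != d)).
Proof.
move=> sym irr free.
pose N x := [set y | r x y].
have [v _ vmax] := @arg_maxnP _ x0 xpredT (fun x => #|N x|) isT.
(* If [a] violates this, maximality of the degree of [v] provides [b] in [N v] outside [N y], and
   [a], [y], [b], [v] form an alternating cycle. *)
have nested y : N y :\ v \subset N v.
  apply/subsetP => a; rewrite !inE => /andP[a_v ya].
  apply: contraT => va.
  have a_vy : a \in N y :\: (v |: N v) by rewrite !inE negb_or a_v va ya.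
  have : (#|N y :\: N v| <= #|N v :\: N y|)%N.
    by rewrite -(leq_add2l #|N y :&: N v|) cardsID setIC cardsID; apply: vmax.
  have [yv|yv] := boolP (r y v).
    have v_yv : v \in N y :\: N v by rewrite !inE irr yv.
    have y_vy : y \in N v :\: N y by rewrite !inE irr sym yv.
    (* When [y] and [v] are adjacent, [b] must also differ from [y]; removing [v] and [y] from the
       two differences keeps the inequality. *)
    rewrite (cardsD1 v (N y :\: _)) (cardsD1 y (N v :\: _)) v_yv y_vy leq_add2l => le.
    have /card_gt0P[b] : (0 < #|(N v :\: N y) :\ y|)%N.
      apply: leq_trans le; apply/card_gt0P; exists a.
      by rewrite !inE a_v va ya.
    rewrite !inE => /and3P[b_y yb vb]; case: (free a y b v).
    - by rewrite sym.
    - by rewrite /compl_rel /= eq_sym b_y.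
    - by rewrite sym.
    - by rewrite /compl_rel /= eq_sym a_v.
  move=> le; have /card_gt0P[b] : (0 < #|N v :\: N y|)%N.
    apply: leq_trans le; apply/card_gt0P; exists a.
    by rewrite !inE va ya.
  rewrite !inE => /andP[yb vb]; case: (free a y b v).
  - by rewrite sym.
  - rewrite /compl_rel /= yb andbT; apply: contra yv => /eqP ->.
    by rewrite sym.
  - by rewrite sym.
  - by rewrite /compl_rel /= eq_sym a_v.
(* A vertex [w] missed by [v] is isolated: a neighbour [x] of [w] would put [w] in [N x], hence in
   [N v]. *)
case: (pickP (fun w => (w != v) && ~~ r v w)) => [w /andP[w_v vw]|dom].
  left; exists w => x; apply: contraNF vw => wx.
  have /subsetP/(_ w) := nested x; rewrite !inE sym wx w_v; exact.
right; exists v => x; have := dom x; have [->|x_v] /= := eqVneq x v.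
  by rewrite irr.
by move/negbFE.
Qed.

End AlternatingFree.

(** * 0-1 matrices of relations and the induction on vertices *)

Section RelationMatrices.
Implicit Types n : nat.

(** Rational entries, because the kernel argument needs a totally ordered field, which [algC] is
    not. *)
Definition relmx n (r : rel 'I_n) : 'M[rat]_n := \matrix_(i, j) (r i j)%:R.

Lemma complmx_relmx n (r : rel 'I_n) :
  irreflexive r -> complmx (relmx r) = relmx (compl_rel r).
Proof.
move=> irr; apply/matrixP => i j; rewrite !mxE /compl_rel /=.
have [->|_] /= := eqVneq i j; first by rewrite irr !subrr.
by case: (r i j); rewrite !subr0 ?subrr.
Qed.

Lemma relmx_sym n (r : rel 'I_n) : symmetric r -> (relmx r)^T = relmx r.
Proof. by move=> sym; apply/matrixP => i j; rewrite !mxE sym. Qed.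

Lemma relmx_mulP n (r s : rel 'I_n) a c :
  reflect (exists b, r a b && s b c) ((relmx r *m relmx s) a c != 0).
Proof.
rewrite mxE psumr_neq0 => [|b _]; last by rewrite !mxE mulr_ge0 ?ler0n.
apply: (iffP hasP) => [[b _]|[b]].
  by rewrite !mxE /= -natrM ltr0n muln_gt0 !lt0b => rs; exists b.
move=> rs; exists b; first exact: mem_index_enum.
by rewrite !mxE /= -natrM ltr0n muln_gt0 !lt0b.
Qed.

(** The trace sums the nonnegative products of [AC a c] and [AC c a]; a nonzero one supplies [b] and
    [d] closing an alternating cycle. *)
Lemma alt4_freeP n (r : rel 'I_n) (AC := relmx r *m relmx (compl_rel r)) :
  alt4_free r <-> \tr (AC *m AC) = 0.
Proof.
have AC_ge0 a c : 0 <= AC a c.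
  by rewrite mxE sumr_ge0 // => b _; rewrite !mxE mulr_ge0 ?ler0n.
split=> [free|tr0 a b c d ab bc cd da].
  rewrite /mxtrace big1 // => a _; rewrite mxE big1 // => c _.
  apply/eqP; apply: contraT; rewrite mulf_eq0 negb_or.
  case/andP => /relmx_mulP[b /andP[ab bc]] /relmx_mulP[d /andP[cd da]].
  by case: (free a b c d).
have /psumr_eq0P := tr0; rewrite /mxtrace.
have AC2_ge0 i : 0 <= (AC *m AC) i i by rewrite mxE sumr_ge0 // => j _; apply: mulr_ge0.
move=> /(_ (fun i _ => AC2_ge0 i) a isT); rewrite mxE => /psumr_eq0P.
move=> /(_ (fun j _ => mulr_ge0 (AC_ge0 a j) (AC_ge0 j a)) c isT) /eqP.
have ac : AC a c != 0 by apply/relmx_mulP; exists b; rewrite ab.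
have ca : AC c a != 0 by apply/relmx_mulP; exists d; rewrite cd.
by rewrite mulf_eq0 (negPf ac) (negPf ca).
Qed.

Lemma cospectral_alt4_free n (r s : rel 'I_n) :
  symmetric r -> irreflexive r -> symmetric s -> irreflexive s ->
  cospectral_with_compl (relmx r) (relmx s) -> alt4_free r -> alt4_free s.
Proof.
move=> rsym rirr ssym sirr rs /alt4_freeP; rewrite -complmx_relmx // => tr0.
apply/alt4_freeP; rewrite -complmx_relmx // tr_alternating.
rewrite tr_alternating in tr0.
rewrite -!(cospectral_walks rs) -[RHS]tr0; congr (_ + _).
have trE k := sym_rat_tr_pow_eq k (relmx_sym ssym) (relmx_sym rsym) (esym rs.1).
by rewrite !trE.
Qed.

Lemma cospectral_perm n (p q : 'S_n) (A B : 'M[rat]_n) :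
  cospectral_with_compl A B ->
  cospectral_with_compl (\matrix_(i, j) A (p i) (p j))
                        (\matrix_(i, j) B (q i) (q j)).
Proof.
have complE (t : 'S_n) (M : 'M[rat]_n) : complmx (\matrix_(i, j) M (t i) (t j)) =
    \matrix_(i, j) complmx M (t i) (t j).
  by apply/matrixP => i j; rewrite !mxE (inj_eq perm_inj).
by case=> eqA eqC; split; rewrite ?complE !char_poly_perm.
Qed.

Definition del_rel n (r : rel 'I_n.+1) (u : 'I_n.+1) : rel 'I_n :=
  [rel i j | r (lift u i) (lift u j)].

(** The permutation [lift_perm ord0 u 1] sends index 0 to [u] and the others, in order, to the
    remaining vertices. *)
Lemma relmx_del n (r : rel 'I_n.+1) u :
  symmetric r -> (forall x, r u x = false) ->
  \matrix_(i, j) relmx r (lift_perm ord0 u 1 i) (lift_perm ord0 u 1 j) =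
  add_isolated (relmx (del_rel r u)).
Proof.
move=> sym iso; apply/(@matrixP _ (1 + n) (1 + n)) => i j; rewrite /add_isolated.
have lsh (k : 'I_1) : lshift n k = ord0 :> 'I_n.+1 by apply: val_inj; rewrite ord1.
case: (split_ordP i) => k ->;
  case: (split_ordP j) => l ->.
- by rewrite block_mxEul !mxE !lsh lift_perm_id iso.
- by rewrite block_mxEur !mxE !lsh lift_perm_id iso.
- by rewrite block_mxEdl !mxE !lsh lift_perm_id sym iso.
- by rewrite block_mxEdr !mxE !rshift1 !lift_perm_lift !perm1.
Qed.

Definition rel_iso n (r s : rel 'I_n) :=
  exists p : 'S_n, forall i j, s (p i) (p j) = r i j.

Lemma rel_iso_compl n (r s : rel 'I_n) :
  irreflexive r -> irreflexive s ->
  rel_iso (compl_rel r) (compl_rel s) -> rel_iso r s.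
Proof.
move=> rirr sirr [p rs]; exists p => i j; have := rs i j.
rewrite /compl_rel /= (inj_eq perm_inj); have [->|_] /= := eqVneq i j.
  by rewrite rirr sirr.
exact: negb_inj.
Qed.

Lemma rel_iso_add_isolated n (r s : rel 'I_n.+1) u v :
  symmetric r -> symmetric s ->
  (forall x, r u x = false) -> (forall x, s v x = false) ->
  rel_iso (del_rel r u) (del_rel s v) -> rel_iso r s.
Proof.
move=> rsym ssym ru sv [p rs]; exists (lift_perm u v p) => i j.
case: (unliftP u i) => [i' ->|->]; last by rewrite lift_perm_id sv ru.
case: (unliftP u j) => [j' ->|->].
  by rewrite !lift_perm_lift; apply: rs.
by rewrite lift_perm_id ssym sv rsym ru.
Qed.

Lemma cospectral_del n (r s : rel 'I_n.+1) u v :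
  symmetric r -> symmetric s ->
  (forall x, r u x = false) -> (forall x, s v x = false) ->
  cospectral_with_compl (relmx r) (relmx s) ->
  cospectral_with_compl (relmx (del_rel r u)) (relmx (del_rel s v)).
Proof.
move=> rsym ssym ru sv.
move/(cospectral_perm (lift_perm ord0 u 1) (lift_perm ord0 v 1)).
rewrite (relmx_del rsym ru) (relmx_del ssym sv).
exact: cospectral_del_isolated.
Qed.

Lemma isolated_dominating_cospectral n (r s : rel 'I_n.+2) u d :
  symmetric r -> symmetric s -> cospectral_with_compl (relmx r) (relmx s) ->
  (forall x, r u x = false) -> (forall x, s d x = (x != d)) -> False.
Proof.
move=> rsym ssym rs ru sd.
apply: (@isolated_neq_dominating _ _ (relmx r) (relmx s) u d (lift d ord0)).
- exact: relmx_sym.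
- exact: relmx_sym.
- exact: rs.1.
- exact: cospectral_walks.
- by move=> j; rewrite mxE ru.
- by move=> j; rewrite mxE sd.
- by rewrite eq_sym neq_lift.
Qed.

Theorem alt4_free_cospectral_iso n (r s : rel 'I_n) :
  symmetric r -> irreflexive r -> symmetric s -> irreflexive s ->
  cospectral_with_compl (relmx r) (relmx s) -> alt4_free r -> rel_iso r s.
Proof.
elim: n r s => [|n IH] r s rsym rirr ssym sirr rs rfree.
  by exists 1%g; case.
(* Stated for arbitrary relations so that it also serves the complements. *)
have IHdel (r' s' : rel 'I_n.+1) u v : symmetric r' -> irreflexive r' ->
    symmetric s' -> irreflexive s' ->
    cospectral_with_compl (relmx r') (relmx s') -> alt4_free r' ->
    (forall x, r' u x = false) -> (forall x, s' v x = false) -> rel_iso r' s'.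
  move=> r'sym r'irr s'sym s'irr rs' free' ru sv.
  apply: (rel_iso_add_isolated _ _ ru sv) => //; apply: IH.
  - by move=> x y; apply: r'sym.
  - by move=> x; apply: r'irr.
  - by move=> x y; apply: s'sym.
  - by move=> x; apply: s'irr.
  - exact: cospectral_del.
  - by move=> a b c d ab bc cd da; apply: (free' _ _ _ _ ab _ cd);
      rewrite /compl_rel /= (inj_eq lift_inj).
(* Excluding the mixed cases requires two vertices, so one vertex is treated apart. *)
case: n {IH} => [|n] in r s rsym rirr ssym sirr rs rfree IHdel *.
  by exists 1%g => i j; rewrite !ord1 rirr sirr.
have sfree := cospectral_alt4_free rsym rirr ssym sirr rs rfree.
have [[u ru]|[u ru]] := isolated_or_dominating ord0 rsym rirr rfree;
have [[v sv]|[v sv]] := isolated_or_dominating ord0 ssym sirr sfree.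
- exact: (IHdel r s u v).
- by case: (isolated_dominating_cospectral rsym ssym rs ru sv).
- by case: (isolated_dominating_cospectral ssym rsym (cospectral_sym rs) sv ru).
(* Two dominating vertices become isolated in the complements. *)
apply: rel_iso_compl => //; apply: (IHdel _ _ u v).
- exact: compl_rel_sym.
- exact: compl_rel_irr.
- exact: compl_rel_sym.
- exact: compl_rel_irr.
- rewrite -(complmx_relmx rirr) -(complmx_relmx sirr).
  exact: cospectral_complmx.
- exact: alt4_free_compl.
- by move=> x; rewrite /compl_rel /= ru eq_sym andbN.
- by move=> x; rewrite /compl_rel /= sv eq_sym andbN.
Qed.

End RelationMatrices.

(** * From spectra of graphs to relations on ordinals *)

(** Monic polynomials split over [algC], and root multiplicities determine the list of roots up to
    order. *)
Lemma same_spectrum_char_poly m n (A : 'M[algC]_m) (B : 'M[algC]_n) :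
  same_spectrum A B -> char_poly A = char_poly B.
Proof.
move=> AB.
have [a] := closed_field_poly_normal (char_poly A).
have [b] := closed_field_poly_normal (char_poly B).
rewrite !(eqP (char_poly_monic _)) !scale1r => Bb Aa.
rewrite Aa Bb; apply: perm_big; apply/allP => x _ /=; apply/eqP.
by have := AB x; rewrite /eigenmult Aa Bb !mu_prod_XsubC.
Qed.

Lemma char_poly_ratr_inj m n (A : 'M[rat]_m) (B : 'M[rat]_n) :
  char_poly (map_mx (ratr : rat -> algC) A) =
  char_poly (map_mx (ratr : rat -> algC) B) -> char_poly A = char_poly B.
Proof. by rewrite -!map_char_poly; apply: map_poly_inj. Qed.

Lemma cospectral_alt4_free_bij m n (r : rel 'I_m) (s : rel 'I_n) :
  symmetric r -> irreflexive r -> symmetric s -> irreflexive s -> alt4_free s ->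
  char_poly (relmx r) = char_poly (relmx s) ->
  char_poly (relmx (compl_rel r)) = char_poly (relmx (compl_rel s)) ->
  exists2 f : 'I_m -> 'I_n, bijective f & forall i j, s (f i) (f j) = r i j.
Proof.
move=> rsym rirr ssym sirr sfree rs rsC.
(* The degree of the characteristic polynomial is the number of vertices. *)
have eq_mn : m = n.
  by have := congr1 (fun p : {poly rat} => (size p).-1) rs; rewrite !size_char_poly.
subst m.
have [|p rp] := alt4_free_cospectral_iso ssym sirr rsym rirr _ sfree.
  split; first exact: esym rs.
  rewrite (complmx_relmx rirr) (complmx_relmx sirr); exact: esym rsC.
exists (p^-1)%g => [|i j]; first by exists p; [exact: permKV | exact: permK].
by rewrite -rp !permKV.
Qed.

Lemma has_induced_embedding (F G : sgraph) (f : F -> G) :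
  injective f -> (forall x y, adj (f x) (f y) = adj x y) -> has_induced F G.
Proof.
move=> f_inj fE; pose S := [set f x | x : F].
have inS x : f x \in S by apply: imset_f.
pose h x : induced S := exist (fun y => y \in S) (f x) (inS x).
have h_inj : injective h by move=> x y [/f_inj].
have [g hK gK] : bijective h.
  apply: inj_card_bij => //.
  by rewrite card_sig (eq_card (B := S)) // card_imset.
exists S; exists g; first by exists h.
by move=> x y; rewrite -{2}(gK x) -{2}(gK y) -[LHS]fE.
Qed.

Lemma threshold_alt4_free (G : sgraph) : threshold G -> alt4_free (@adj G).
Proof.
case=> no2K2 noP4 noC4 a b c d ab /andP[b_c bc] cd /andP[d_a da].
have irr := @adj_irrefl G; have sym := @adj_sym G.
(* The four vertices are distinct: [b] is adjacent to [a] but not to [c], and [a] is adjacent to [b]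
   but not to [d]. *)
have a_b : a != b by apply: contraTneq ab => ->; rewrite irr.
have c_d : c != d by apply: contraTneq cd => ->; rewrite irr.
have a_c : a != c by apply: contraTneq ab => ->; rewrite sym.
have b_d : b != d by apply: contraTneq ab => ->; rewrite sym.
have embed (r : rel 'I_4) (rsym : symmetric r) (rirr : irreflexive r)
    (x0 x1 x2 x3 : G) :
    uniq [:: x0; x1; x2; x3] ->
    [/\ adj x0 x1 = r 0 1, adj x0 x2 = r 0 2%:R & adj x0 x3 = r 0 3%:R] ->
    [/\ adj x1 x2 = r 1 2%:R, adj x1 x3 = r 1 3%:R & adj x2 x3 = r 2%:R 3%:R] ->
    has_induced (SGraph rsym rirr) G.
  move=> uniq_x [e01 e02 e03] [e12 e13 e23].
  have ordE (i : 'I_4) : [\/ i = 0, i = 1, i = 2%:R | i = 3%:R].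
    case: i => [[|[|[|[|]]]]] // lt; [constructor 1 | constructor 2 |
      constructor 3 | constructor 4]; exact: val_inj.
  apply: (@has_induced_embedding (SGraph rsym rirr) G
            (fun i : 'I_4 => nth x0 [:: x0; x1; x2; x3] i)).
    move=> i j /eqP; rewrite nth_uniq //; first by move/eqP/val_inj.
  move=> i j; change (adj (nth x0 [:: x0; x1; x2; x3] i)
                          (nth x0 [:: x0; x1; x2; x3] j) = r i j).
  by case: (ordE i) => ->; case: (ordE j) => -> /=;
    rewrite ?irr ?rirr // ?e01 // sym rsym.
(* Only the pairs [a c] and [b d] are undetermined: both adjacent give [C4], exactly one gives [P4],
   none gives [twoK2]. *)
have [ac|ac] := boolP (adj a c); have [bd|bd] := boolP (adj b d).
- apply: noC4; apply: (embed _ _ _ a b d c).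
  + by rewrite /= !inE !negb_or a_b a_c b_d b_c eq_sym d_a eq_sym c_d.
  + by rewrite ab ac sym (negPf da).
  + by rewrite bd (negPf bc) sym cd.
- apply: noP4; apply: (embed _ _ _ b a c d).
  + by rewrite /= !inE !negb_or eq_sym a_b b_c b_d a_c eq_sym d_a c_d.
  + by rewrite sym ab (negPf bc) (negPf bd).
  + by rewrite ac sym (negPf da) cd.
- apply: noP4; apply: (embed _ _ _ a b d c).
  + by rewrite /= !inE !negb_or a_b a_c b_d b_c eq_sym d_a eq_sym c_d.
  + by rewrite ab (negPf ac) sym (negPf da).
  + by rewrite bd (negPf bc) sym cd.
- apply: no2K2; apply: (embed _ _ _ a b c d).
  + by rewrite /= !inE !negb_or a_b a_c b_d b_c eq_sym d_a c_d.
  + by rewrite ab (negPf ac) sym (negPf da).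
  + by rewrite (negPf bc) (negPf bd) cd.
Qed.

Definition ord_adj (G : sgraph) : rel 'I_#|G| :=
  [rel i j | adj (enum_val i) (enum_val j)].

Lemma adjmx_ratr (G : sgraph) : adjmx G = map_mx ratr (relmx (ord_adj (G := G))).
Proof. by apply/matrixP => i j; rewrite !mxE ratr_nat. Qed.

Lemma adjmx_compl_ratr (G : sgraph) :
  adjmx (complement G) = map_mx ratr (relmx (compl_rel (ord_adj (G := G)))).
Proof.
apply/matrixP => i j; rewrite !mxE ratr_nat.
by rewrite /= /compl_adj /compl_rel /= (inj_eq enum_val_inj).
Qed.

Theorem mainTheorem4 (G : sgraph) (hG : threshold G) : DGS G.
Proof.
move=> H [/same_spectrum_char_poly eqA /same_spectrum_char_poly eqC].
rewrite !adjmx_ratr in eqA; rewrite !adjmx_compl_ratr in eqC.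
have [] := cospectral_alt4_free_bij _ _ _ _ _
  (char_poly_ratr_inj eqA) (char_poly_ratr_inj eqC).
- by move=> i j; apply: adj_sym.
- by move=> i; apply: adj_irrefl.
- by move=> i j; apply: adj_sym.
- by move=> i; apply: adj_irrefl.
- move=> a b c d ab bc cd da; apply: (threshold_alt4_free hG ab _ cd).
  + by move: bc; rewrite /compl_rel /= (inj_eq enum_val_inj).
  + by move: da; rewrite /compl_rel /= (inj_eq enum_val_inj).
move=> f f_bij fE; exists (fun x => enum_val (f (enum_rank x))).
  exact: bij_comp (@enum_val_bij _) (bij_comp f_bij (@enum_rank_bij _)).
by move=> x y; have := fE (enum_rank x) (enum_rank y); rewrite /ord_adj /= !enum_rankK.
Qed.
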